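(* Let $H=(V,E,w)$, the measure-space operator $L$, and $\gamma_2$ be as in the context. Consider the deterministic diffusion process $\frac{d\varphi_t}{dt}=-L\varphi_t$ started from a probability measure $\varphi_0\in\mathbb{R}_{\ge0}^V$ with $\sum_u\varphi_0(u)=1$. Then for every $\delta>0$ the mixing time satisfies $t^{\mathrm{mix}}_\delta(\varphi_0)\le\frac{1}{\gamma_2}\log\frac{1}{\delta\sqrt{\varphi^*_{\min}}}$, where $\varphi^*=\frac{1}{w(V)}W\mathbf{1}$ and $\varphi^*_{\min}=\min_{u\in V}\varphi^*(u)$.
   Context: $H=(V,E,w)$: $V$ finite, $n=|V|\ge2$, hyperedges are nonempty subsets of $V$, $w_e\ge0$, vertex weights $w_v=\sum_{e\ni v}w_e>0$, $w(X)=\sum_{v\in X}w_v$, $W=\mathrm{diag}(w_v)$, $\mathbf{1}$ all-ones. Normalized discrepancy ratio $\mathcal{D}(x)=\frac{\sum_{e}w_e\max_{u,v\in e}(x_u/\sqrt{w_u}-x_v/\sqrt{w_v})^2}{\sum_u x_u^2}$ and $\gamma_2=\min\{\mathcal{D}(x):0\ne x\perp W^{1/2}\mathbf{1}\}$. Laplacian. For $f\in\mathbb{R}^V$, $e\in E$: $S_e(f)$ ($I_e(f)$) is the set of $u\in e$ with $f_u$ maximal (minimal) in $e$, $c_e=w_e(\max_ef-\min_ef)$, $c(F)=\sum_{e\in F}c_e$. Define $r=r(f)$: partition $V$ into classes of equal $f$-value; for each class $U$ start with $E_U=\{e:(I_e(f)\cup S_e(f))\cap U\neq\emptyset\}$;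 for nonempty $X\subseteq U$ let $I_X=\{e\in E_U:I_e(f)\subseteq X\}$, $S_X=\{e\in E_U:S_e(f)\cap X\ne\emptyset\}$, $\delta(X)=(c(I_X)-c(S_X))/w(X)$; choose nonempty $P\subseteq U$ maximizing $\delta$, set $r_u=\delta(P)$ on $P$, and repeat with $U\setminus P$ and edge set $E_U\setminus(I_P\cup S_P)$ (result independent of choices). Set $\mathcal{L}_wf=-r(f)$ and, on the measure space, $L\varphi=W\mathcal{L}_w(W^{-1}\varphi)$. Derivatives in the process are right-derivatives. Mixing time: $t^{\mathrm{mix}}_\delta(\varphi_0)$ is the smallest $\tau$ such that $\|\varphi_t-\varphi^*\|_1\le\delta$ for all $t\ge\tau$.
   Formalization: After P is removed, an edge counts in I_X when its minimizers not yet removed lie in X (read literally, r would depend on the choice of P); the threshold τ in the mixing time may be negative, since for δ>1/√φ*_min the stated bound is negative; 1/γ_2 is +∞ when γ_2=0. *)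

(* Defs.v *)
From HB Require Import structures.
From mathcomp Require Import all_boot all_order all_algebra.
From mathcomp Require Import all_classical all_reals all_analysis.

Set Implicit Arguments.
Unset Strict Implicit.
Unset Printing Implicit Defensive.

Import Order.TTheory GRing.Theory Num.Theory.
Import numFieldNormedType.Exports.

Local Open Scope classical_set_scope.
Local Open Scope ring_scope.

Record hypergraph (R : realType) (V : finType) := Hypergraph {
  edges : {set {set V}} ;
  eweight : {set V} -> R ;
  edge_neq0 : forall e, e \in edges -> e != finset.set0 ;
  eweight_ge0 : forall e, e \in edges -> 0 <= eweight e ;
  degree_gt0 : forall v, 0 < \sum_(e in edges | v \in e) eweight e
}.

Section Hypergraph.
Context {R : realType} {V : finType} (H : hypergraph R V).
Implicit Types (f x phi : V -> R) (e U Q X : {set V}) (F : {set {set V}}).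

Definition vweight (v : V) : R := \sum_(e in edges H | v \in e) eweight H e.

Definition volume X : R := \sum_(v in X) vweight v.

(* The maximum ranges over nonempty e and squares, so the default value 0 of
   the iterated maximum never contributes. *)
Definition discrepancy x : R :=
  (\sum_(e in edges H) eweight H e *
     \big[Num.max/0]_(u in e) \big[Num.max/0]_(v in e)
       (x u / Num.sqrt (vweight u) - x v / Num.sqrt (vweight v)) ^+ 2)
  / \sum_u x u ^+ 2.

(* The infimum is a minimum: discrepancy is continuous and invariant under
   scaling, hence attains its minimum on the unit sphere of the hyperplane. *)
Definition gamma2 : R :=
  inf [set discrepancy x | x in
    [set x : V -> R | x != 0 /\ \sum_u x u * Num.sqrt (vweight u) = 0]].

Definition argmaxs f e : {set V} :=
  [set u in e | [forall v in e, f v <= f u]]%SET.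

Definition argmins f e : {set V} :=
  [set u in e | [forall v in e, f u <= f v]]%SET.

Definition ecost f e : R :=
  eweight H e * (sup [set f u | u in [set` e]] - inf [set f u | u in [set` e]]).

Definition cost f F : R := \sum_(e in F) ecost f e.

(* A state of the procedure on a class U0 of f is a pair (Q, F): Q is the set
   of vertices of U0 already treated, so that U0 :\: Q remain, and F is the set
   of remaining edges.  The vertices of Q have left the scene, so an edge of F
   is filled by X when all its *remaining* minimizers are in X, that is when
   argmins f e \subset Q :|: X; at the first step Q is empty.  Asking instead
   for argmins f e \subset X at later steps would drop every edge whose
   minimizers are separated by an earlier step: the result would depend on the
   choice of maximizers, and mass would not be conserved. *)
Definition filled f Q F X : {set {set V}} :=
  [set e in F | argmins f e \subset Q :|: X]%SET.

Definition drained f F X : {set {set V}} :=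
  [set e in F | argmaxs f e :&: X != finset.set0]%SET.

Definition density f Q F X : R :=
  (cost f (filled f Q F X) - cost f (drained f F X)) / volume X.

Definition densest f Q F U : {set V} :=
  [arg max_(X > U | (X != finset.set0) && (X \subset U)) density f Q F X]%O.

(* Each step treats at least one vertex, so #|V| steps exhaust any class. *)
Fixpoint rate_steps (steps : nat) f (U0 : {set V}) Q F (u : V) : R :=
  if steps is k.+1 then
    let P := densest f Q F (U0 :\: Q) in
    if u \in P then density f Q F P
    else rate_steps k f U0 (Q :|: P)
           (F :\: (filled f Q F P :|: drained f F P)) u
  else 0.

Definition level_class f (u : V) : {set V} := [set v | f v == f u]%SET.

Definition class_edges f U : {set {set V}} :=
  [set e in edges H | (argmins f e :|: argmaxs f e) :&: U != finset.set0]%SET.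

Definition rate f (u : V) : R :=
  rate_steps #|V| f (level_class f u) finset.set0
    (class_edges f (level_class f u)) u.

Definition weighted_laplacian f (u : V) : R := - rate f u.

Definition laplacian phi (u : V) : R :=
  vweight u * weighted_laplacian (fun v => phi v / vweight v) u.

(* Solutions are continuous on [0, +oo[: right-differentiability alone would
   allow jumps. *)
Definition diffusion (phi0 : V -> R) (phi : R -> V -> R) : Prop :=
  [/\ phi 0 = phi0,
      forall u, {within `[0, +oo[, continuous (fun t => phi t u)} &
      forall (t : R) (u : V), 0 <= t ->
        h^-1 * (phi (t + h) u - phi t u) @[h --> 0^'+] -->
          - laplacian (phi t) u].

Definition stationary (u : V) : R := vweight u / volume [set: V]%SET.

Definition stationary_min : R := inf (range stationary).

Definition l1norm x : R := \sum_u `|x u|.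

(* phi is only meaningful at times t >= 0, whereas the threshold tau is an
   arbitrary real.  The infimum is the least threshold when there is one; it is
   +oo if phi does not eventually stay within delta of the stationary measure,
   and -oo if phi is within delta of it at all times. *)
Definition mixing_time (phi : R -> V -> R) (delta : R) : \bar R :=
  ereal_inf [set tau%:E | tau in
    [set tau : R | forall t : R, 0 <= t -> tau <= t ->
       l1norm (fun u => phi t u - stationary u) <= delta]].

End Hypergraph.

(* Main.v *)
Require Import Defs.
From HB Require Import structures.
From mathcomp Require Import all_boot all_order all_algebra.
From mathcomp Require Import all_classical all_reals all_analysis.
From mathcomp Require Import ring lra.

Import Order.TTheory GRing.Theory Num.Theory.
Import numFieldNormedType.Exports.

Local Open Scope classical_set_scope.
Local Open Scope ring_scope.

(* Write f = W^-1 phi and c = 1 / w(V).  On each level class the procedure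
   distributes exactly the cost of the edges having their minimizers there,
   minus the cost of those having their maximizers there.  Hence, for every g,
     sum_u w_u r_u g(f_u) = sum_e c_e (g(min_e f) - g(max_e f)).
   With g = 1 the total mass is conserved; with g(y) = y - c the energy
   sum_u w_u (f_u - c)^2 has right-derivative -2 sum_e w_e (max_e f - min_e f)^2,
   which is at most -2 gamma2 times the energy because W^(1/2) (f - c) is
   orthogonal to W^(1/2) 1.  So the energy decays like exp(-2 gamma2 t), and
   Cauchy-Schwarz turns this into
     |phi_t - phi^*|_1 <= exp(-gamma2 t) / sqrt(phi^*_min)  for all t >= 0.
   If the logarithm in the bound is not positive, this is at most delta at all
   times, and the mixing time is -oo. *)

Lemma inf_range_attained (R : realType) (I : finType) (i0 : I) (g : I -> R) :
  exists2 i, inf (range g) = g i & forall j, g i <= g j.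
Proof.
case: (arg_minP (P := xpredT) g (erefl : xpredT i0)) => i _ gi.
have lbg : lbound (range g) (g i) by move=> _ [j _ <-]; exact: gi.
exists i => [|j]; last exact: gi.
apply/eqP; rewrite eq_le; apply/andP; split.
  by apply: ge_inf; [exists (g i) | exists i].
by apply: lb_le_inf => //; exists (g i), i.
Qed.

(** * Edge extrema and the total rate distributed by the procedure *)

Section LaplacianRate.
Context {R : realType} {V : finType} (H : hypergraph R V).
Implicit Types (f : V -> R) (e U Q X : {set V}) (F : {set {set V}}).

(** Names for the [sup] and [inf] inside [ecost], so that they can be folded there. *)
Definition emax f e : R := sup [set f u | u in [set` e]].
Definition emin f e : R := inf [set f u | u in [set` e]].

Lemma in_argmaxs f e u : (u \in argmaxs f e) = (u \in e) && (f u == emax f e).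
Proof.
rewrite inE; case: (boolP (u \in e)) => //= ue.
have ub v : v \in e -> (forall w, w \in e -> f w <= f v) -> emax f e = f v.
  move=> ve fv; apply/eqP; rewrite eq_le; apply/andP; split.
    by apply: ge_sup => [|_ [w we <-]]; [exists (f v), v | exact: fv].
  by apply: ub_le_sup; [exists (f v) => _ [w we <-]; exact: fv | exists v].
apply/forall_inP/eqP => [fu|-> v ve]; first by rewrite (ub u).
case: (arg_maxP f ue) => w we fw.
by rewrite (ub w we fw); exact: fw.
Qed.

Lemma in_argmins f e u : (u \in argmins f e) = (u \in e) && (f u == emin f e).
Proof.
rewrite inE; case: (boolP (u \in e)) => //= ue.
have lb v : v \in e -> (forall w, w \in e -> f v <= f w) -> emin f e = f v.
  move=> ve fv; apply/eqP; rewrite eq_le; apply/andP; split.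
    by apply: ge_inf; [exists (f v) => _ [w we <-]; exact: fv | exists v].
  by apply: lb_le_inf => [|_ [w we <-]]; [exists (f v), v | exact: fv].
apply/forall_inP/eqP => [fu|-> v ve]; first by rewrite (lb u).
case: (arg_minP f ue) => w we fw.
by rewrite (lb w we fw); exact: fw.
Qed.

Lemma argmaxs_neq0 f {e} : e != finset.set0 -> argmaxs f e != finset.set0.
Proof.
case/set0Pn=> u ue; case: (arg_maxP f ue) => v ve fv.
by apply/set0Pn; exists v; rewrite inE (ve : v \in e); apply/forall_inP.
Qed.

Lemma argmins_neq0 f {e} : e != finset.set0 -> argmins f e != finset.set0.
Proof.
case/set0Pn=> u ue; case: (arg_minP f ue) => v ve fv.
by apply/set0Pn; exists v; rewrite inE (ve : v \in e); apply/forall_inP.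
Qed.

Lemma le_emax f {e u} : u \in e -> f u <= emax f e.
Proof.
move=> ue; have /set0Pn[v] : argmaxs f e != finset.set0.
  by apply: argmaxs_neq0; apply/set0Pn; exists u.
rewrite in_argmaxs => /andP[ve /eqP fv]; have : v \in argmaxs f e.
  by rewrite in_argmaxs ve fv eqxx.
by rewrite inE -fv => /andP[_ /forall_inP]; apply.
Qed.

Lemma ge_emin f {e u} : u \in e -> emin f e <= f u.
Proof.
move=> ue; have /set0Pn[v] : argmins f e != finset.set0.
  by apply: argmins_neq0; apply/set0Pn; exists u.
rewrite in_argmins => /andP[ve /eqP fv]; have : v \in argmins f e.
  by rewrite in_argmins ve fv eqxx.
by rewrite inE -fv => /andP[_ /forall_inP]; apply.
Qed.

Lemma vweight_gt0 u : 0 < vweight H u.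
Proof. exact: degree_gt0. Qed.

Lemma volume_gt0 X : X != finset.set0 -> 0 < volume H X.
Proof.
case/set0Pn=> u uX; rewrite /volume (big_setD1 u uX) /=.
by rewrite ltr_wpDr ?vweight_gt0 ?sumr_ge0 // => v _; rewrite ltW ?vweight_gt0.
Qed.

Lemma densest_spec f Q F U : U != finset.set0 ->
  (densest H f Q F U != finset.set0) && (densest H f Q F U \subset U).
Proof.
move=> U0; rewrite /densest.
by case: arg_maxP => //; rewrite U0 subxx.
Qed.

(** The tests of [filled] and [drained] applied to the whole class: the net coefficient of the cost
    of [e] once the procedure has finished, whatever the order of its steps. *)
Definition inflow_sign f U e : R :=
  (argmins f e \subset U)%:R - (argmaxs f e :&: U != finset.set0)%:R.

(* Maximality of the chosen set plays no role: conservation holds whichever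
   nonempty subset a step picks.  A remaining edge of nonzero
   cost meets U0 through its minimizers or through its maximizers, but not
   both, and is paid for exactly once. *)
Lemma sum_rate_steps k f U0 Q F :
    (#|U0 :\: Q| <= k)%N -> Q \subset U0 ->
    (forall e, e \in F -> ecost H f e != 0 ->
       [/\ ~~ ((argmins f e \subset U0) && (argmaxs f e :&: U0 != finset.set0)),
           ~~ (argmins f e \subset Q) & argmaxs f e :&: Q == finset.set0]) ->
  \sum_(u in U0 :\: Q) vweight H u * rate_steps H k f U0 Q F u =
  \sum_(e in F) ecost H f e * inflow_sign f U0 e.
Proof.
(* An exhausted class means [Q' = U0], and the invariant then makes both indicators zero for every
   leftover edge of nonzero cost. Serves for zero fuel and for early exhaustion. *)
have done0 l (Q' : {set V}) F' : U0 :\: Q' = finset.set0 -> Q' \subset U0 ->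
    (forall e, e \in F' -> ecost H f e != 0 ->
       [/\ ~~ ((argmins f e \subset U0) && (argmaxs f e :&: U0 != finset.set0)),
           ~~ (argmins f e \subset Q') & argmaxs f e :&: Q' == finset.set0]) ->
  \sum_(u in U0 :\: Q') vweight H u * rate_steps H l f U0 Q' F' u =
  \sum_(e in F') ecost H f e * inflow_sign f U0 e.
  move=> UQ QU inv; rewrite UQ big_set0 big1 // => e eF.
  have [->|ce] := eqVneq (ecost H f e) 0; first by rewrite mul0r.
  have UeQ : U0 = Q'.
    by apply/eqP; rewrite finset.eqEsubset QU andbT -finset.setD_eq0 UQ.
  have [_ /negbTE nI /eqP S0] := inv e eF ce.
  by rewrite /inflow_sign UeQ nI S0 eqxx subr0 mulr0.
elim: k Q F => [|k IH] Q F cardQ QU inv.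
  by apply: done0 => //; apply/eqP; rewrite -cards_eq0 -leqn0.
have [UQ|UQ] := eqVneq (U0 :\: Q)%SET finset.set0; first exact: done0.
have /andP[] := densest_spec f Q F _ UQ.
set P := densest H f Q F (U0 :\: Q) => P0 PU.
have PU0 : P \subset U0 by apply: fintype.subset_trans PU (finset.subsetDl _ _).
rewrite (big_setID P) /= (finset.setIidPr PU).
rewrite (eq_bigr (fun u => density H f Q F P * vweight H u)); last first.
  by move=> u uP; rewrite /= -/P uP mulrC.
(* The rate is constant on [P], so its weighted sum is the cost filled minus the cost drained. *)
rewrite -mulr_sumr -/(volume H P) {1}/density divfK ?gt_eqF ?volume_gt0 //.
rewrite finset.setDDl.
set F' := (F :\: (filled f Q F P :|: drained f F P))%SET.
rewrite (eq_bigr (fun u => vweight H u * rate_steps H k f U0 (Q :|: P) F' u)); last first.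
  by move=> u; rewrite !inE /= -/P => /andP[/norP[_ /negbTE->]].
(* Edges left in [F'] are neither filled nor drained by [P], which gives the invariant for
   [Q :|: P]; as [P] is nonempty, fewer vertices remain. *)
rewrite IH; first last.
- move=> e; rewrite !inE => /andP[/norP[nfil ndr] eF] ce.
  rewrite eF /= in nfil ndr; have [h1 h2 h3] := inv e eF ce.
  by split=> //; rewrite finset.setIUr (eqP h3) finset.set0U; move: ndr; rewrite negbK.
- by rewrite finset.subUset QU.
- rewrite -ltnS (leq_trans _ cardQ) //; apply: proper_card.
  have /set0Pn[u uP] := P0; have := fintype.subsetP PU u uP.
  rewrite inE => /andP[uQ uU]; apply/properP; split.
    by apply: finset.setDS; exact: finset.subsetUl.
  by exists u; rewrite !inE ?uQ ?uU // uP orbT.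
(* Indicators turn the three sums into sums over [F], compared edge by edge. *)
have restrict (F1 : {set {set V}}) (G : {set V} -> R) : F1 \subset F ->
    \sum_(e in F1) G e = \sum_(e in F) (e \in F1)%:R * G e.
  move=> F1F; rewrite [RHS](big_setID F1) /= (finset.setIidPr F1F).
  rewrite [X in _ = _ + X]big1 ?addr0 => [|e]; last first.
    by rewrite inE => /andP[/negbTE-> _]; rewrite mul0r.
  by apply: eq_bigr => e ->; rewrite mul1r.
rewrite /cost (restrict (filled f Q F P)) ?(restrict (drained f F P)) ?(restrict F'); first last.
- by apply/fintype.subsetP => e; rewrite inE => /andP[].
- by apply/fintype.subsetP => e; rewrite inE => /andP[].
- exact: finset.subsetDl.
rewrite -sumrB -big_split /=; apply: eq_bigr => e eF.
have [->|ce] := eqVneq (ecost H f e) 0; first by rewrite !(mulr0, mul0r) subr0 addr0.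
have [h1 h2 h3] := inv e eF ce; rewrite !inE eF /= /inflow_sign andbT.
(* A filled edge has its minimizers in [U0], hence no maximizer there: sign 1. A drained edge that
   is not filled has sign -1. Any other edge is deferred to [F']. *)
have [fil|nfil] /= := boolP (argmins f e \subset Q :|: P).
  have IU : argmins f e \subset U0.
    by apply: fintype.subset_trans fil _; rewrite finset.subUset QU.
  move: h1; rewrite IU /= negbK => /eqP SU0.
  have SP0 : argmaxs f e :&: P = finset.set0.
    by apply/eqP; rewrite -finset.subset0 -SU0 finset.setIS.
  by rewrite SU0 SP0 eqxx /=; ring.
have [dr|ndr] := boolP (argmaxs f e :&: P != finset.set0); last by rewrite /=; ring.
have SU : argmaxs f e :&: U0 != finset.set0.
  apply: contra_neq dr => SU0.
  by apply/eqP; rewrite -finset.subset0 -SU0 finset.setIS.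
by move: h1; rewrite SU andbT => /negbTE->; rewrite /=; ring.
Qed.

(* Summing over the level classes, each edge enters through its minimum value
   and leaves through its maximum value. *)
Lemma sum_rate f (g : R -> R) :
  \sum_u vweight H u * rate H f u * g (f u) =
  \sum_(e in edges H) ecost H f e * (g (emin f e) - g (emax f e)).
Proof.
(* [choose] depends only on the value [f u], so the fixed points of [rep] index the level
   classes. *)
pose rep u := choose (fun v => f v == f u) u.
have f_rep u : f (rep u) = f u.
  exact/eqP/(chooseP (P := fun v => f v == f u)).
have rep_eq u v : f u = f v -> rep u = rep v.
  rewrite /rep => fuv.
  rewrite (eq_choose (Q := fun w => f w == f v)) => [|w]; last by rewrite /= fuv.
  by apply: choose_id; rewrite ?fuv.
rewrite (partition_big rep (fun v => rep v == v)) => [|u _]; last first.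
  by apply/eqP/rep_eq.
transitivity (\sum_(v | rep v == v) \sum_(e in edges H)
    ecost H f e * (((f v == emin f e)%:R - (f v == emax f e)%:R) * g (f v))).
  apply: eq_bigr => v /eqP repv.
  have classE u : (rep u == v) = (u \in level_class f v).
    rewrite inE; apply/eqP/eqP => [<-|/rep_eq->//]; by rewrite f_rep.
  have levelE u : u \in level_class f v -> level_class f u = level_class f v.
    by rewrite inE => /eqP fuv; apply/setP => w; rewrite !inE fuv.
  (* The minimizers of an edge share one value, and a nonempty edge has one: either all of them lie
     in the class or none does. *)
  have IE e : e \in edges H -> (argmins f e \subset level_class f v) = (f v == emin f e).
    move=> eH; apply/fintype.subsetP/eqP => [sub|fv u].
      have /set0Pn[u uI] := argmins_neq0 f (edge_neq0 eH).
      by have := sub u uI; move: uI; rewrite in_argmins inE => /andP[_ /eqP->] /eqP.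
    by rewrite in_argmins inE fv => /andP[].
  have ME e : e \in edges H -> (argmaxs f e :&: level_class f v != finset.set0) = (f v == emax f e).
    move=> eH; apply/set0Pn/eqP => [[u]|fv].
      by rewrite finset.in_setI in_argmaxs inE => /andP[/andP[_ /eqP->] /eqP].
    have /set0Pn[u uS] := argmaxs_neq0 f (edge_neq0 eH).
    by exists u; rewrite finset.in_setI uS inE fv; move: uS; rewrite in_argmaxs => /andP[].
  have CE e : e \in edges H ->
      (e \in class_edges H f (level_class f v)) = (f v == emin f e) || (f v == emax f e).
    move=> eH; rewrite inE eH /= finset.setIUl finset.setU_eq0 negb_and ME //; congr (_ || _).
    apply/set0Pn/eqP => [[u]|fv].
      by rewrite finset.in_setI in_argmins inE => /andP[/andP[_ /eqP->] /eqP].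
    have /set0Pn[u uS] := argmins_neq0 f (edge_neq0 eH).
    by exists u; rewrite finset.in_setI uS inE fv; move: uS; rewrite in_argmins => /andP[].
  transitivity (\sum_(u in level_class f v :\: finset.set0) vweight H u *
      rate_steps H #|V| f (level_class f v) finset.set0
        (class_edges H f (level_class f v)) u * g (f v)).
    apply: eq_big => [u|u]; first by rewrite finset.setD0 classE.
    rewrite classE => uU; rewrite /rate levelE //.
    by move: uU; rewrite inE => /eqP->.
  rewrite -mulr_suml sum_rate_steps ?finset.sub0set //; first last.
  - move=> e eC ce; have eH : e \in edges H by move: eC; rewrite inE => /andP[].
    rewrite finset.setI0 eqxx finset.subset0 argmins_neq0 ?(edge_neq0 eH) //; split=> //.
    (* An edge with both extrema in one class has constant [f], hence zero cost. *)
    rewrite IE // ME //; apply: contra ce => /andP[/eqP m /eqP M].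
    by rewrite /ecost -/(emax f e) -/(emin f e) -m -M subrr mulr0.
  - by apply: max_card.
  rewrite mulr_suml big_mkcond [RHS]big_mkcond; apply: eq_bigr => e _.
  have [eH|eH] := boolP (e \in edges H); last first.
    by rewrite inE (negbTE eH).
  rewrite CE // /inflow_sign IE // ME //.
  case: (f v == emin f e); case: (f v == emax f e); rewrite /= ?mulrA //.
  by rewrite subrr mulr0 mul0r.
rewrite exchange_big /=; apply: eq_bigr => e eH; rewrite -mulr_sumr; congr (_ * _).
(* Only [rep u] represents the value [f u], so the sum over classes collapses to one term. *)
have pick_value u : \sum_(v | rep v == v) (f v == f u)%:R * g (f v) = g (f u).
  rewrite (bigD1 (rep u)) /=; last by apply/eqP/rep_eq/f_rep.
  rewrite f_rep eqxx mul1r big1 ?addr0 // => v /andP[/eqP repv nv].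
  case: eqP => [fvu|_]; last by rewrite mul0r.
  by move: nv; rewrite -repv (rep_eq _ _ fvu) eqxx.
have /set0Pn[u] := argmins_neq0 f (edge_neq0 eH).
rewrite in_argmins => /andP[_ /eqP <-].
have /set0Pn[w] := argmaxs_neq0 f (edge_neq0 eH).
rewrite in_argmaxs => /andP[_ /eqP <-].
rewrite -(pick_value u) -(pick_value w) -sumrB.
by apply: eq_bigr => v _; rewrite mulrBl.
Qed.

(** * The spectral gap inequality *)

Lemma gamma2_ge0 : 0 <= gamma2 H.
Proof.
rewrite /gamma2; set S := [set _ | _ in _].
(* The infimum of the empty set is 0 by default. *)
have [->|S0] := eqVneq S classical_sets.set0; first by rewrite inf0.
apply: lb_le_inf; first exact/set0P.
move=> _ [x _ <-]; rewrite /discrepancy divr_ge0 ?sumr_ge0 // => [e eH|u _].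
  rewrite mulr_ge0 ?eweight_ge0 //; by apply: bigmax_ge_id.
exact: sqr_ge0.
Qed.

(** The test vector is W^(1/2) (f - c): rescaled by W^(-1/2), its differences on an edge are those
    of [f], at most [emax f e - emin f e]. *)
Lemma gamma2_le f (c : R) : \sum_u vweight H u * (f u - c) = 0 ->
  gamma2 H * \sum_u vweight H u * (f u - c) ^+ 2 <=
  \sum_(e in edges H) eweight H e * (emax f e - emin f e) ^+ 2.
Proof.
move=> orth; pose x u := Num.sqrt (vweight H u) * (f u - c).
have w0 u : Num.sqrt (vweight H u) != 0 by rewrite gt_eqF // sqrtr_gt0 vweight_gt0.
have xE u : x u / Num.sqrt (vweight H u) = f u - c by rewrite /x mulrAC divff ?mul1r.
have x2 u : x u ^+ 2 = vweight H u * (f u - c) ^+ 2.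
  by rewrite /x exprMn sqr_sqrtr // ltW ?vweight_gt0.
rewrite -(eq_bigr _ (fun u _ => x2 u)).
(* The zero vector is not admissible in [gamma2], but for it the left side vanishes. *)
have [x0|x0] := eqVneq (\sum_u x u ^+ 2) 0.
  rewrite x0 mulr0 sumr_ge0 // => e eH.
  by rewrite mulr_ge0 ?eweight_ge0 ?sqr_ge0.
have xgt0 : 0 < \sum_u x u ^+ 2 by rewrite lt_def x0 sumr_ge0 // => u _; exact: sqr_ge0.
rewrite -ler_pdivlMr //.
apply: (@le_trans _ _ (discrepancy H x)).
  apply: ge_inf.
    exists 0 => _ [y _ <-]; rewrite /discrepancy divr_ge0 ?sumr_ge0 // => [e eH|u _].
      rewrite mulr_ge0 ?eweight_ge0 //; by apply: bigmax_ge_id.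
    exact: sqr_ge0.
  exists x => //; split.
    apply: contra_neq x0 => ->; rewrite big1 // => u _; exact: expr0n.
  rewrite -[RHS]orth; apply: eq_bigr => u _.
  by rewrite /x mulrAC -expr2 sqr_sqrtr // ltW ?vweight_gt0.
rewrite /discrepancy ler_pM2r ?invr_gt0 //; apply: ler_sum => e eH.
apply: ler_wpM2l; first exact: eweight_ge0.
apply: bigmax_le => [|u ue]; first exact: sqr_ge0.
apply: bigmax_le => [|v ve]; first exact: sqr_ge0.
rewrite !xE -ler_sqrt ?sqr_ge0 // !sqrtr_sqr.
have := (le_emax f ue, le_emax f ve, ge_emin f ue, ge_emin f ve).
move=> [[[uM vM] um] vm]; rewrite [leRHS]ger0_norm; last by lra.
by rewrite ler_norml; apply/andP; split; lra.
Qed.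

End LaplacianRate.

(** * Calculus of right-derivatives *)

Section RightDerivative.
Context {R : realType}.
Implicit Types (F G : R -> R) (t l m : R).

Definition right_deriv F t l := h^-1 * (F (t + h) - F t) @[h --> 0^'+] --> l.

(** [F (t + h)] is [h] times the difference quotient plus [F t]. The product rule needs this
    right-continuity. *)
Lemma right_deriv_cvg F t l : right_deriv F t l -> F (t + h) @[h --> 0^'+] --> F t.
Proof.
move=> dF.
have : h * (h^-1 * (F (t + h) - F t)) + F t @[h --> 0^'+] --> 0 * l + F t.
  apply: cvgD; last exact: cvg_cst.
  by apply: cvgM; [apply: cvg_at_right_filter; exact: cvg_id | exact: dF].
rewrite mul0r add0r; apply: cvg_trans; apply: near_eq_cvg; near=> h.
rewrite mulrA divff ?mul1r ?subrK //; near: h; exact: nbhs_right_neq.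
Unshelve. all: by end_near. Qed.

Lemma right_deriv_cst a t : right_deriv (fun=> a) t 0.
Proof.
rewrite /right_deriv; under eq_fun do rewrite subrr mulr0.
exact: cvg_cst.
Qed.

Lemma right_derivD F G t l m :
  right_deriv F t l -> right_deriv G t m -> right_deriv (fun s => F s + G s) t (l + m).
Proof.
move=> dF dG; rewrite /right_deriv.
rewrite (_ : (fun h => _) =
  (fun h => h^-1 * (F (t + h) - F t) + h^-1 * (G (t + h) - G t))).
  exact: cvgD.
by apply/funext => h; ring.
Qed.

Lemma right_derivM F G t l m : right_deriv F t l -> right_deriv G t m ->
  right_deriv (fun s => F s * G s) t (l * G t + F t * m).
Proof.
move=> dF dG; rewrite /right_deriv.
rewrite (_ : (fun h => _) =
  (fun h => h^-1 * (F (t + h) - F t) * G (t + h) + F t * (h^-1 * (G (t + h) - G t)))).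
  apply: cvgD; apply: cvgM => //; [exact: right_deriv_cvg dG | exact: cvg_cst].
by apply/funext => h; ring.
Qed.

Lemma right_deriv_sum (I : finType) (F : I -> R -> R) t (l : I -> R) :
  (forall i, right_deriv (F i) t (l i)) ->
  right_deriv (fun s => \sum_i F i s) t (\sum_i l i).
Proof.
move=> dF; elim: (index_enum I) => [|i r IH].
  rewrite big_nil (_ : (fun s => _) = (fun=> 0)); first exact: right_deriv_cst.
  by apply/funext => s; rewrite big_nil.
rewrite big_cons (_ : (fun s => _) = (fun s => F i s + \sum_(j <- r) F j s)).
  exact: right_derivD.
by apply/funext => s; rewrite big_cons.
Qed.

Lemma right_deriv_expR a t :
  right_deriv (fun s => expR (a * s)) t (a * expR (a * t)).
Proof.
have dE : is_derive t 1 (fun s => expR (a * s)) (a * expR (a * t)).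
  rewrite mulrC; apply: is_derive1_comp; apply: is_derive_eq.
  by rewrite -[RHS]mulr1.
have := @ex_derive _ _ _ _ _ _ _ dE.
rewrite /derivable => cv.
have dl := @derive_val _ _ _ _ _ _ _ dE; rewrite /derive in dl.
move: cv; rewrite dl => /cvg_dnbhs_at_right.
rewrite /right_deriv; apply: cvg_trans; apply: near_eq_cvg; near=> h.
by rewrite /= /shift /= /GRing.scale /= mulr1 (addrC t).
Unshelve. all: by end_near. Qed.


(** Every line of slope [eps > 0] from [F 0] dominates [F]: the last time [s] up to which this holds
    is reached by continuity, and the right-derivative at [s] would carry the bound further if
    [s < T]. *)
Lemma right_deriv_le0_nonincreasing F :
  (forall t, 0 <= t -> F s @[s --> within `[0, +oo[ (nbhs t)] --> F t) ->
  (forall t, 0 <= t -> exists2 l, l <= 0 & right_deriv F t l) ->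
  forall t, 0 <= t -> F t <= F 0.
Proof.
move=> cF dF T T0.
apply/ler_addgt0Pr => e0 e0_gt0.
(* Makes [eps * T] at most [e0]; the summand 1 covers [T = 0]. *)
pose eps := e0 / (T + 1).
have eps0 : 0 < eps by rewrite divr_gt0 // ltr_wpDl.
apply: (@le_trans _ _ (F 0 + eps * T)); last first.
  rewrite lerD2l /eps mulrAC ler_pdivrMr ?ltr_wpDl // ler_pM2l //; lra.
pose A := [set s | 0 <= s <= T /\ forall r, 0 <= r <= s -> F r <= F 0 + eps * r].
have A0 : A 0.
  split=> [|r]; first by rewrite lexx.
  by rewrite -eq_le => /eqP <-; rewrite mulr0 addr0.
have supA : has_sup A by split; [exists 0 | exists T => s [/andP[]]].
pose s := sup A.
have s0 : 0 <= s by apply: ub_le_sup => //; case: supA.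
have sT : s <= T by apply: ge_sup; [exists 0 | move=> r [/andP[]]].
have below r : 0 <= r < s -> F r <= F 0 + eps * r.
  move=> /andP[r0 rs]; have [a Aa ra] := sup_adherent (eps := s - r) ltac:(lra) supA.
  by case: Aa => _; apply; apply/andP; split => //; rewrite -/s in ra; lra.
have As r : 0 <= r <= s -> F r <= F 0 + eps * r.
  move=> /andP[r0]; rewrite le_eqVlt => /orP[/eqP ->|rs]; last by apply: below; rewrite r0.
  (* An excess over the line at [s] would persist at points just to its left, against [below]. *)
  rewrite leNgt; apply/negP => gap.
  have sgt0 : 0 < s.
    rewrite lt_def s0 andbT; apply: contraTneq gap => ->.
    by rewrite mulr0 addr0 ltxx.
  have /cvgrPdist_lt/(_ (F s - (F 0 + eps * s)) ltac:(lra)) := cF s s0.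
  move=> /nbhs_ballP[d /= d0 near_s].
  (* [d / 2] keeps [r1] in the ball, [s / 2] keeps it nonnegative. *)
  pose r1 := s - Num.min (d / 2) (s / 2).
  have [m0 md ms] : [/\ 0 < Num.min (d / 2) (s / 2),
      Num.min (d / 2) (s / 2) <= d / 2 & Num.min (d / 2) (s / 2) <= s / 2].
    rewrite lt_min !ge_min !lexx orbT; split=> //; apply/andP; split; lra.
  have : `|F s - F r1| < F s - (F 0 + eps * s).
    apply: near_s; last by rewrite /= in_itv /= andbT /r1; lra.
    by rewrite /ball /= ltr_norml /r1; apply/andP; split; lra.
  have := below r1 ltac:(rewrite /r1; apply/andP; split; lra).
  have : eps * r1 <= eps * s by rewrite ler_pM2l // /r1; lra.
  rewrite ltr_norml => ? ? /andP[]; lra.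
suff -> : T = s by apply: As; rewrite s0 lexx.
apply/eqP; rewrite eq_le sT andbT leNgt; apply/negP => ltsT.
(* Just after [s] the quotients stay below [l + eps <= eps], so the line dominates up to some
   [s + h], beyond the supremum. *)
have [l l0 dl] := dF s s0.
have /cvgrPdist_lt/(_ eps eps0) near_s := dl.
have [h [h0 hT A_h]] : exists h, [/\ 0 < h, h <= T - s & forall r, 0 <= r <= s + h -> F r <= F 0 + eps * r].
  move: near_s => /nbhs_ballP[d /= d0 near_s].
  pose h := Num.min (d / 2) (T - s).
  have [h0 hd hT] : [/\ 0 < h, h <= d / 2 & h <= T - s].
    rewrite /h lt_min !ge_min !lexx orbT; split=> //; apply/andP; split; lra.
  have quot k : 0 < k <= h -> `|l - k^-1 * (F (s + k) - F s)| < eps.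
    move=> /andP[k0 kh]; apply: near_s => //.
    by rewrite /ball /= sub0r normrN gtr0_norm //; lra.
  exists h; split=> // r /andP[r0 rsh].
  have [rs|sr] := leP r s; first by apply: As; rewrite r0.
  have := quot (r - s) ltac:(apply/andP; split; lra).
  rewrite (addrC s) subrK ltr_norml => /andP[up _].
  have : (r - s)^-1 * (F r - F s) < eps by lra.
  rewrite mulrC ltr_pdivrMr ?subr_gt0 // => Fr.
  have := As s; rewrite s0 lexx => /(_ isT); lra.
have : s + h <= s.
  apply: ub_le_sup; first by case: supA.
  by split=> //; apply/andP; split; lra.
lra.
Qed.

End RightDerivative.

(** * Mass conservation and energy decay along a diffusion *)

Section Diffusion.
Context {R : realType} {V : finType} (H : hypergraph R V).
Context (phi0 : V -> R) (phi : R -> V -> R).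
Context (phi_diffusion : diffusion H phi0 phi).

(** The vector W^-1 phi_t, not to be confused with the quotient [density] of the procedure. *)
Let density_of (t : R) (u : V) := phi t u / vweight H u.

(** For c = 1 / w(V) this is the chi-square divergence of phi_t from the stationary measure, divided
    by w(V). *)
Definition energy (c t : R) : R :=
  \sum_u vweight H u * (density_of t u - c) ^+ 2.

Lemma diffusion_cvg u (t : R) : 0 <= t ->
  phi s u @[s --> within `[0, +oo[ (nbhs t)] --> phi t u.
Proof.
case: phi_diffusion => _ cphi _ t0.
have /subspace_continuousP := cphi u; apply.
by rewrite /= in_itv /= t0.
Qed.

Lemma diffusion_right_deriv u (t : R) : 0 <= t ->
  right_deriv (fun s => phi s u) t (vweight H u * rate H (density_of t) u).
Proof.
case: phi_diffusion => _ _ dphi t0; have := dphi t u t0.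
by rewrite /laplacian /weighted_laplacian mulrN opprK.
Qed.

(** The right-derivative is zero by [sum_rate] with g = 1; monotonicity applied to the mass and to
    its negative makes it constant. *)
Lemma diffusion_mass (t : R) : 0 <= t -> \sum_u phi t u = \sum_u phi0 u.
Proof.
move=> t0; have <- : phi 0 = phi0 by case: phi_diffusion.
have dmass (s : R) : 0 <= s -> right_deriv (fun r => \sum_u phi r u) s 0.
  move=> s0; have := right_deriv_sum _ (fun u r => phi r u) s _ (fun u => diffusion_right_deriv u s s0).
  rewrite (_ : \sum_u _ = 0) //.
  rewrite -(eq_bigr _ (fun u _ => mulr1 _)).
  rewrite (sum_rate H (density_of s) (fun=> 1)) big1 // => e _.
  by rewrite subrr mulr0.
have cmass (s : R) : 0 <= s ->
    \sum_u phi r u @[r --> within `[0, +oo[ (nbhs s)] --> \sum_u phi s u.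
  move=> s0; apply: cvg_big => [|u _]; [exact: add_continuous | exact: diffusion_cvg].
apply/eqP; rewrite eq_le; apply/andP; split.
  apply: (right_deriv_le0_nonincreasing (fun r => \sum_u phi r u)) => // s s0.
  by exists 0 => //; exact: dmass.
rewrite -lerN2.
apply: (right_deriv_le0_nonincreasing (fun r => - \sum_u phi r u)) => // s s0.
  by apply: cvgN; exact: cmass.
exists 0 => //; have := right_derivM _ _ _ _ _ (right_deriv_cst (-1) s) (dmass s s0).
rewrite mul0r mulr0 addr0; congr right_deriv.
by apply/funext => r; rewrite mulN1r.
Qed.

Lemma energy_right_deriv c (t : R) : 0 <= t ->
  right_deriv (energy c) t
    (- (2 * \sum_(e in edges H) eweight H e *
         (emax (density_of t) e - emin (density_of t) e) ^+ 2)).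
Proof.
move=> t0; have dterm u : right_deriv
    (fun s => vweight H u * (density_of s u - c) ^+ 2) t
    (2 * (vweight H u * rate H (density_of t) u * (density_of t u - c))).
  have w0 : vweight H u != 0 by rewrite gt_eqF ?vweight_gt0.
  have ddev := right_derivD _ _ _ _ _
    (right_derivM _ _ _ _ _ (diffusion_right_deriv u t t0)
      (right_deriv_cst (vweight H u)^-1 t)) (right_deriv_cst (- c) t).
  have := right_derivM _ _ _ _ _ (right_deriv_cst (vweight H u) t)
    (right_derivM _ _ _ _ _ ddev ddev).
  rewrite /density_of; congr right_deriv.
  by field.
have := right_deriv_sum _ _ _ _ dterm.
rewrite -mulr_sumr (sum_rate H (density_of t) (fun y => y - c)).
congr right_deriv; rewrite -mulrN -sumrN; congr (_ * _); apply: eq_bigr => e _.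
by rewrite /ecost -/(emax _ e) -/(emin _ e); ring.
Qed.

(** Integrating factor: the energy times [expR (2 * gamma2 H * t)] is nonincreasing. The hypothesis
    makes [c] the weighted mean of [density_of]. *)
Lemma energy_decay c (t : R) : c * volume H [set: V]%SET = \sum_u phi0 u -> 0 <= t ->
  energy c t <= energy c 0 * expR (- (2 * gamma2 H * t)).
Proof.
move=> hc t0; rewrite expRN ler_pdivlMr ?expR_gt0 //.
have -> : energy c 0 = energy c 0 * expR (2 * gamma2 H * 0).
  by rewrite mulr0 expR0 mulr1.
apply: (right_deriv_le0_nonincreasing (fun r => energy c r * expR (2 * gamma2 H * r))) => // s s0.
  apply: cvgM.
    apply: cvg_big => [|u _]; first exact: add_continuous.
    have cdev : density_of r u - c @[r --> within `[0, +oo[ (nbhs s)] --> density_of s u - c.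
      apply: cvgB; last exact: cvg_cst.
      by apply: cvgM; [exact: diffusion_cvg | exact: cvg_cst].
    by apply: cvgM; [exact: cvg_cst | exact: cvgM].
  apply: cvg_within_filter.
  apply: (continuous_comp (f := fun r => 2 * gamma2 H * r)); last exact: continuous_expR.
  exact: mulrl_continuous.
have dE := right_derivM _ _ _ _ _ (energy_right_deriv c s s0)
  (right_deriv_expR (2 * gamma2 H) s).
eexists; last exact: dE.
(* Mass conservation keeps [c] the weighted mean at time [s], as [gamma2_le] requires. *)
have orth : \sum_u vweight H u * (density_of s u - c) = 0.
  under eq_bigr => u _.
    rewrite mulrBr /density_of mulrC divfK ?gt_eqF ?vweight_gt0 //.
    over.
  have volE : volume H [set: V]%SET = \sum_u vweight H u.
    by apply: eq_bigl => u; rewrite inE.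
  by rewrite sumrB (diffusion_mass s s0) -mulr_suml -hc volE mulrC subrr.
rewrite mulrA -mulrDl pmulr_lle0 ?expR_gt0 //.
rewrite addrC subr_le0 (mulrC (energy c s)) -mulrA ler_pM2l //.
exact: gamma2_le.
Qed.

End Diffusion.

(** * From energy decay to the mixing time *)

Section MixingTime.
Context {R : realType} {V : finType} (H : hypergraph R V).

Lemma stationary_minP (v0 : V) :
  0 < stationary_min H /\ forall u, stationary_min H <= stationary H u.
Proof.
rewrite /stationary_min; have [v -> vmin] := inf_range_attained R V v0 (stationary H).
split=> //; rewrite divr_gt0 ?vweight_gt0 ?volume_gt0 //.
by apply/set0Pn; exists v; rewrite inE.
Qed.

Lemma l1norm_diffusion_le (phi0 : V -> R) (phi : R -> V -> R) (t : R) :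
    (forall u, 0 <= phi0 u) -> \sum_u phi0 u = 1 ->
    diffusion H phi0 phi -> 0 <= t ->
  l1norm (fun u => phi t u - stationary H u) <=
    expR (- (gamma2 H * t)) / Num.sqrt (stationary_min H).
Proof.
move=> p0 p1 hphi t0.
(* An empty [V] could not carry total mass 1. *)
have [v0 _] : exists v0 : V, true.
  apply/existsP; apply: contraT => /existsPn nV.
  by have := oner_neq0 R; rewrite -p1 big1 ?eqxx // => u; have := nV u.
have [min_gt0 min_le] := stationary_minP v0.
have W0 : 0 < volume H [set: V]%SET.
  by apply: volume_gt0; apply/set0Pn; exists v0; rewrite inE.
set W := volume H [set: V]%SET in W0.
have WE : W = \sum_u vweight H u by apply: eq_bigl => u; rewrite inE.
have w0 u : 0 < vweight H u by exact: vweight_gt0.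
have [phi_0 _ _] := hphi.
(* Expanding the square leaves the sum of phi0(u)^2 / w_u minus 1 / W; then phi0(u) <= 1 and w_u >=
   W times the stationary minimum. *)
have start : energy H phi W^-1 0 <= (W * stationary_min H)^-1.
  apply: (@le_trans _ _ (\sum_u phi0 u ^+ 2 / vweight H u)).
    have -> : energy H phi W^-1 0 = \sum_u phi0 u ^+ 2 / vweight H u - W^-1.
      transitivity (\sum_u (phi0 u ^+ 2 / vweight H u - 2 * W^-1 * phi0 u + W^-1 ^+ 2 * vweight H u)).
        apply: eq_bigr => u _; rewrite phi_0; have := gt_eqF (w0 u) => /negbT wu.
        have := gt_eqF W0 => /negbT ?.
        by field; apply/andP.
      rewrite big_split sumrB /= -!mulr_sumr p1 -WE.
      by field; rewrite gt_eqF.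
    by rewrite lerBlDr lerDl invr_ge0 ltW.
  apply: (@le_trans _ _ (\sum_u (W * stationary_min H)^-1 * phi0 u)); last first.
    by rewrite -mulr_sumr p1 mulr1.
  apply: ler_sum => u _.
  have pu : phi0 u <= 1.
    by rewrite -p1 (bigD1 u) //= lerDl sumr_ge0.
  rewrite expr2 -mulrA mulrC ler_wpM2r //.
  apply: (@le_trans _ _ (vweight H u)^-1).
    by rewrite ler_piMl // invr_ge0 ltW.
  rewrite lef_pV2 ?posrE ?mulr_gt0 //.
  by have := min_le u; rewrite /stationary -/W ler_pdivlMr // mulrC.
have decay := energy_decay H phi0 phi hphi W^-1 t ltac:(by rewrite p1 mulVf ?gt_eqF) t0.
set S := l1norm _.
have SE : S = \sum_u vweight H u * `|phi t u / vweight H u - W^-1|.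
  apply: eq_bigr => u _; rewrite -[X in X * _]gtr0_norm // -normrM.
  by rewrite mulrBr mulrC divfK ?gt_eqF.
have cauchy_schwarz : S ^+ 2 <= W * energy H phi W^-1 t.
  (* Cauchy-Schwarz as nonnegativity of a weighted variance: [S / W] is the mean of the absolute
     deviations. *)
  have : 0 <= \sum_u vweight H u * (`|phi t u / vweight H u - W^-1| - S / W) ^+ 2.
    by apply: sumr_ge0 => u _; rewrite mulr_ge0 ?sqr_ge0 ?ltW.
  have -> : \sum_u vweight H u * (`|phi t u / vweight H u - W^-1| - S / W) ^+ 2 =
      energy H phi W^-1 t - S ^+ 2 / W.
    transitivity (\sum_u (vweight H u * (phi t u / vweight H u - W^-1) ^+ 2 -
        2 * (S / W) * (vweight H u * `|phi t u / vweight H u - W^-1|) +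
        (S / W) ^+ 2 * vweight H u)).
      by apply: eq_bigr => u _; rewrite -[in RHS]real_normK ?num_real //; ring.
    rewrite big_split sumrB /= -!mulr_sumr -SE -WE -/(energy H phi W^-1 t).
    by field; rewrite gt_eqF.
  by rewrite subr_ge0 ler_pdivrMr // mulrC.
have S0 : 0 <= S by apply: sumr_ge0.
rewrite -(@ler_pXn2r _ 2) ?nnegrE ?divr_ge0 ?expR_ge0 ?sqrtr_ge0 //.
rewrite expr_div_n sqr_sqrtr; last exact: ltW.
apply: le_trans cauchy_schwarz _.
have -> : expR (- (gamma2 H * t)) ^+ 2 = expR (- (2 * gamma2 H * t)).
  by rewrite -expRM_natl; congr expR; ring.
apply: (@le_trans _ _ (W * ((W * stationary_min H)^-1 * expR (- (2 * gamma2 H * t))))).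
  rewrite ler_pM2l //; apply: le_trans decay _.
  by rewrite ler_pM2r ?expR_gt0.
by rewrite invfM !mulrA mulfV ?gt_eqF // mul1r mulrC.
Qed.

End MixingTime.

(* The bound is an extended real: 1 / gamma2 is +oo when gamma2 = 0. *)
Theorem mainTheorem3 (R : realType) (V : finType) (hV : (2 <= #|V|)%N)
    (H : hypergraph R V) (phi0 : V -> R) (phi : R -> V -> R)
    (phi0_ge0 : forall u, 0 <= phi0 u) (phi0_sum1 : \sum_u phi0 u = 1)
    (hphi : diffusion H phi0 phi) (delta : R) (delta_gt0 : 0 < delta) :
  (mixing_time H phi delta <=
     ((gamma2 H)%:E)^-1 *
     (ln (1 / (delta * Num.sqrt (stationary_min H))))%:E)%E.
Proof.
have [v0 _] : exists v0 : V, true.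
  by apply/card_gt0P; apply: leq_trans hV.
have [min_gt0 _] := stationary_minP H v0.
have ds0 : 0 < delta * Num.sqrt (stationary_min H) by rewrite mulr_gt0 ?sqrtr_gt0.
(* Taking logarithms in the l1 bound turns a threshold into a linear condition on [t]. *)
have mix tau : (forall t : R, 0 <= t -> tau <= t ->
    - (gamma2 H * t) <= ln (delta * Num.sqrt (stationary_min H))) ->
    (mixing_time H phi delta <= tau%:E)%E.
  move=> tauP; apply: ereal_inf_lbound; exists tau => // t t0 taut.
  apply: le_trans (l1norm_diffusion_le H phi0 phi t phi0_ge0 phi0_sum1 hphi t0) _.
  rewrite ler_pdivrMr ?sqrtr_gt0 //.
  by rewrite -ler_ln ?posrE ?expR_gt0 // expRK tauP.
rewrite div1r lnV ?posrE //; set l := ln _ in mix *.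
(* For [0 <= l] every real is a threshold, so the mixing time is -oo, also when [gamma2 H] is 0. *)
have [l0|l0] := leP 0 l.
  have mix_all tau : (mixing_time H phi delta <= tau%:E)%E.
    apply: mix => t t0 _.
    by apply: le_trans l0; rewrite oppr_le0 mulr_ge0 ?gamma2_ge0.
  case: (mixing_time H phi delta) mix_all => [r /(_ (r - 1))|/(_ 0)|]; last by rewrite leNye.
    by rewrite lee_fin => ?; exfalso; lra.
  by rewrite leye_eq.
have := gamma2_ge0 H; rewrite le_eqVlt => /orP[/eqP g0|g0].
  (* The inverse of 0 is +oo, and its product with [- l > 0] is +oo. *)
  by rewrite inver -g0 eqxx gt0_mulye ?leey // lte_fin oppr_gt0.
(* The threshold is [- l] divided by [gamma2 H]. *)
rewrite inver gt_eqF // -EFinM; apply: mix => t t0.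
by rewrite mulrC ler_pdivrMr // => lt; rewrite lerNl mulrC.
Qed.
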